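(* Let $k_3,k_4>0$ be the constants given in the context. For every $\alpha\in\mathcal{K}_l$ and every $v>0$, the lower bound $\underline{\theta}_{\min}(\alpha;v)=\sup_{0<V\le v}\left[\frac{\alpha(V)-k_3V}{k_4\sqrt V}\right]_+$ is endpoint-dominated, i.e. $$\underline{\theta}_{\min}(\alpha;v)=\left[\frac{\alpha(v)-k_3v}{k_4\sqrt{v}}\right]_+.$$
   Context: $\mathcal{K}_l$ is the set of linear class-$\mathcal{K}$ functions, $\alpha(V)=\sigma V$ with $\sigma>0$. $[z]_+=\max\{z,0\}$. In the supremum $V$ is a scalar variable. The constants are $k_3=\frac{L_1L_2}{k_1}>0$ and $k_4=\frac{L_2}{\sqrt{k_1}}\sum_{i=1}^m\bar g_i>0$. They come from a control-affine system $\dot x=f(x)+g(x)u$, $g=[g_1,\dots,g_m]$, on a set $\mathbb{X}\subset\mathbb{R}^n$ with control Lyapunov function $V$ satisfying, for all $x\in\mathbb{X}$, $k_1\|x\|^2\le V(x)$ ($k_1>0$), $\|f(x)\|\le L_1\|x\|$, $\|\nabla V(x)\|\le L_2\|x\|$ and $\|g_i(x)\|\le\bar g_i$ ($L_1,L_2>0$); the claim involves the system only through the positive constants $k_3,k_4$. *)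

(* Defs.v *)
From HB Require Import structures.
From mathcomp Require Import all_boot all_order all_algebra.
From mathcomp Require Import all_classical all_reals all_analysis.
Set Implicit Arguments.
Unset Strict Implicit.
Unset Printing Implicit Defensive.
Import Order.TTheory GRing.Theory Num.Theory.
Local Open Scope classical_set_scope.
Local Open Scope ring_scope.

(* Class-K functions live on [0, +oo[: the values of alpha : R -> R at negative
   arguments are left unconstrained. *)
Definition linear_classK (R : realType) : set (R -> R) :=
  [set alpha | exists2 sigma : R, 0 < sigma &
                 forall V : R, 0 <= V -> alpha V = sigma * V].

(* k3 and k4 come from a system x' = f(x) + \sum_i g_i(x) u_i with a control
   Lyapunov function V such that k1 |x|^2 <= V(x), |f(x)| <= L1 |x|,
   |grad V(x)| <= L2 |x| and |g_i(x)| <= gbar_i. *)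
Definition k3 (R : realType) (k1 L1 L2 : R) : R := L1 * L2 / k1.

Definition k4 (R : realType) (m : nat) (k1 L2 : R) (gbar : 'I_m -> R) : R :=
  L2 / Num.sqrt k1 * \sum_(i < m) gbar i.

Definition pospart (R : realType) (z : R) : R := Num.max z 0.

(* The supremum is taken in the extended reals, so that it is meaningful without
   assuming that the set is bounded above. *)
Definition theta_min (R : realType) (c3 c4 : R) (alpha : R -> R) (v : R) :
    \bar R :=
  ereal_sup [set (pospart ((alpha V - c3 * V) / (c4 * Num.sqrt V)))%:E
            | V in [set V : R | 0 < V <= v]].

(* Main.v *)
Require Import Defs.
From HB Require Import structures.
From mathcomp Require Import all_boot all_order all_algebra.
From mathcomp Require Import all_classical all_reals all_analysis.
Import Order.TTheory GRing.Theory Num.Theory.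
Local Open Scope classical_set_scope.
Local Open Scope ring_scope.

(** Since [V = sqrt V * sqrt V], the quotient under the supremum is, for
    [alpha V = sigma * V], a constant multiple of [sqrt V]:
    [(sigma * V - c3 * V) / (c4 * sqrt V) = ((sigma - c3) / c4) * sqrt V].
    Taking the positive part replaces the slope [(sigma - c3) / c4], whose sign
    is arbitrary, by its positive part, so the result is a nondecreasing function
    of [V] ([bound_linear], [le_bound]). A nondecreasing function attains its
    supremum over an interval closed on the right at that end
    ([ereal_sup_oc_right_end]). *)

Lemma pospartMr (R : realType) (a s : R) :
  0 <= s -> pospart (a * s) = pospart a * s.
Proof. by move=> s0; rewrite /pospart maxr_pMl// mul0r. Qed.

Lemma bound_linear (R : realType) (c3 c4 sigma V : R) : 0 < V ->
  pospart ((sigma * V - c3 * V) / (c4 * Num.sqrt V)) =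
  pospart ((sigma - c3) / c4) * Num.sqrt V.
Proof.
move=> V0; have s0 : 0 < Num.sqrt V by rewrite sqrtr_gt0.
rewrite -pospartMr ?sqrtr_ge0//; congr (pospart _).
rewrite -mulrBl -[X in _ * X / _](sqr_sqrtr (ltW V0)) expr2 mulrA.
by rewrite -mulf_div divff ?gt_eqF// mulr1 mulrAC.
Qed.

(** Truncation at [0] is what makes this hold for every slope: when
    [(sigma - c3) / c4] is negative, the quotient itself is decreasing in [V]. *)
Lemma le_bound (R : realType) (c3 c4 sigma V W : R) : 0 < V -> V <= W ->
  pospart ((sigma * V - c3 * V) / (c4 * Num.sqrt V)) <=
  pospart ((sigma * W - c3 * W) / (c4 * Num.sqrt W)).
Proof.
move=> V0 VW; have W0 := lt_le_trans V0 VW.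
rewrite !bound_linear// ler_wpM2l//; first by rewrite /pospart le_max lexx orbT.
by rewrite ler_sqrt// ltW.
Qed.

Lemma ereal_sup_oc_right_end (R : realType) (f : R -> R) (a b : R) : a < b ->
  (forall x, a < x <= b -> f x <= f b) ->
  ereal_sup [set (f x)%:E | x in [set x | a < x <= b]] = (f b)%:E.
Proof.
move=> ab fb; apply/eqP; rewrite eq_le; apply/andP; split.
  by apply: ge_ereal_sup => _ [x xab <-]; rewrite lee_fin fb.
by apply: ereal_sup_ubound; exists b => //=; rewrite ab lexx.
Qed.

Theorem proposition4 (R : realType) (m : nat) (k1 L1 L2 : R) (gbar : 'I_m -> R)
  (hk1 : 0 < k1) (hL1 : 0 < L1) (hL2 : 0 < L2)
  (hk3 : 0 < k3 k1 L1 L2) (hk4 : 0 < k4 k1 L2 gbar)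
  (alpha : R -> R) (halpha : linear_classK alpha) (v : R) (hv : 0 < v) :
  theta_min (k3 k1 L1 L2) (k4 k1 L2 gbar) alpha v =
  (pospart ((alpha v - k3 k1 L1 L2 * v) / (k4 k1 L2 gbar * Num.sqrt v)))%:E.
Proof.
case: halpha => sigma _ alphaE.
apply: (@ereal_sup_oc_right_end R (fun V => pospart
  ((alpha V - k3 k1 L1 L2 * V) / (k4 k1 L2 gbar * Num.sqrt V)))) => //.
move=> V /andP[V0 Vv].
rewrite (alphaE V (ltW V0)) (alphaE v (ltW hv)); exact: le_bound.
Qed.
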